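(* Let $\mathcal{B}_1$ be the set of functions $f:\mathbb{R}\to\mathbb{R}$ of Baire class one and let $\mathcal{DB}_1$ be the set of those $f\in\mathcal{B}_1$ having the Darboux property. Then the set $\mathcal{B}_1\setminus\mathcal{DB}_1$ is strongly $\mathfrak{c}$-algebrable (as a subset of the algebra $\mathbb{R}^{\mathbb{R}}$).
   Context: A function $f:\mathbb{R}\to\mathbb{R}$ is of Baire class one if it is a pointwise limit of a sequence of continuous functions; it has the Darboux property if it maps every interval onto a connected set. $\mathfrak{c}=2^{\omega}$ is the cardinality of the continuum. $\mathbb{R}^{\mathbb{R}}$ is the real commutative algebra of all functions $\mathbb{R}\to\mathbb{R}$ with pointwise operations. A subset $S$ of a commutative real algebra $\mathcal{L}$ is strongly $\kappa$-algebrable if $S\cup\{0\}$ contains a $\kappa$-generated algebra isomorphic to a free (commutative, non-unital) algebra; equivalently, there is a set $X\subseteq\mathcal{L}$ of cardinality $\kappa$ such that for every $k\ge 1$, every nonzero real polynomial $P$ in $k$ variables without constant term and all distinct $y_1,\dots,y_k\in X$, we have $P(y_1,\dots,y_k)\neq 0$ and $P(y_1,\dots,y_k)\in S$. *)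

(* Defs.v *)
From HB Require Import structures.
From mathcomp Require Import all_boot all_order all_algebra.
From mathcomp Require Import all_classical all_reals all_analysis.
(* Only the canonical structures of mpoly are imported: its notations clash
   with those of MathComp-Analysis. *)
From mathcomp Require mpoly.
Import (canonicals) mpoly.

Set Implicit Arguments.
Unset Strict Implicit.
Unset Printing Implicit Defensive.

Import Order.TTheory GRing.Theory Num.Theory.
Import numFieldNormedType.Exports.

Local Open Scope classical_set_scope.
Local Open Scope card_scope.
Local Open Scope ring_scope.

(* The library gives [U -> A] its pointwise ring and module structures; only
   the compatibility of scaling with the product is missing to make it an
   algebra. *)
Section FunctionAlgebra.
Variables (U : pointedType) (K : comNzRingType) (A : comAlgType K).

Let fct_scalerAl (a : K) (f g : U -> A) : a *: (f * g) = (a *: f) * g.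
Proof. by apply/funext => x; exact: scalerAl. Qed.

HB.instance Definition _ :=
  GRing.Lmodule_isLalgebra.Build K (U -> A) fct_scalerAl.

Let fct_scalerAr (a : K) (f g : U -> A) : a *: (f * g) = f * (a *: g).
Proof. by apply/funext => x; exact: scalerAr. Qed.

HB.instance Definition _ :=
  GRing.Lalgebra_isAlgebra.Build K (U -> A) fct_scalerAr.

End FunctionAlgebra.

Lemma mmap_fctE (R : realType) (k : nat) (y : 'I_k -> R -> R)
    (P : mpoly.mpoly k R) (x : R) :
  mpoly.mmap (GRing.in_alg (R -> R)%type) y P x = mpoly.meval (y^~ x) P.
Proof.
have prodE (F : 'I_k -> R -> R) : (\prod_i F i) x = \prod_i F i x.
  by apply: (big_morph (fun f : R -> R => f x)).
have expE (f : R -> R) n : (f ^+ n) x = f x ^+ n.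
  by elim: n => // n IH; rewrite !exprS -IH.
rewrite /mpoly.meval /mpoly.mmap fct_sumE; apply: eq_bigr => m _.
rewrite [LHS]/GRing.mul /=; congr (_ * _); first exact: mulr1.
by rewrite /mpoly.mmap1 prodE; apply: eq_bigr => i _; exact: expE.
Qed.

(* The cardinal kappa is represented by any set having that cardinality.
   [mpoly.mmap (GRing.in_alg L) y P] is the value P(y_0, ..., y_(k-1)) in [L],
   and [mpoly.mcoeff mpoly.mnm0 P] is the constant term of [P]. *)
Definition strongly_algebrable (R : realType) (L : comAlgType R) (T : Type)
    (kappa : set T) (S : set L) : Prop :=
  exists X : set L, X #= kappa /\
    forall (k : nat) (P : mpoly.mpoly k R) (y : 'I_k -> L),
      (1 <= k)%N -> P != 0 -> mpoly.mcoeff mpoly.mnm0 P = 0 ->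
      injective y -> (forall i, X (y i)) ->
      mpoly.mmap (GRing.in_alg L) y P <> 0 /\
      S (mpoly.mmap (GRing.in_alg L) y P).
Arguments strongly_algebrable R L {T} kappa S.

(* 2 ^ omega, as the power set of the natural numbers *)
Definition continuum : set (set nat) := [set: set nat].

Definition baire_one (R : realType) (f : R -> R) : Prop :=
  exists g : nat -> R -> R,
    (forall n, continuous (g n)) /\
    (forall x, g n x @[n --> \oo] --> f x).

Definition darboux (R : realType) (f : R -> R) : Prop :=
  forall I : set R, is_interval I -> connected (f @` I).

Definition B1 (R : realType) : set (R -> R) := [set f | baire_one f].
Arguments B1 : clear implicits.

Definition DB1 (R : realType) : set (R -> R) :=
  [set f | B1 R f /\ darboux f].
Arguments DB1 : clear implicits.

(* Main.v *)
Require Import Defs.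
From mathcomp Require Import all_boot all_order all_algebra.
From mathcomp Require Import all_classical all_reals all_analysis.
From mathcomp Require Import lra.
From mathcomp Require mpoly.
Import (canonicals, coercions) mpoly.

Import Order.TTheory GRing.Theory Num.Theory.
Import numFieldNormedType.Exports.

Local Open Scope classical_set_scope.

(** The functions of this proof vanish outside the natural numbers.  Each such
function has Baire class one, whatever its values at the naturals, because it
is the limit of finite sums of ever narrower bumps; and it is not Darboux
unless it is zero, since it maps the interval [[n, n + 1/2]] onto a set with
exactly two elements as soon as it does not vanish at [n].  Functions of this
kind are moreover stable under polynomials without constant term, which act
on the sequence of values.  So everything reduces to finding continuum many
sequences that satisfy no nonzero polynomial equation.

For this, take a Fichtenholz-Kantorovich-Hausdorff independent family: to each
set [A] of natural numbers is attached a sequence of naturals in such a way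
that, for finitely many distinct sets, some common index [n] gives the
sequences any prescribed values ([independent_seqP]).  A nonzero polynomial
does not vanish at some point with natural coordinates
([exists_nat_nonroot]); prescribing these coordinates shows that the
polynomial of the sequences is nonzero at [n]. *)

(** * Nonzero real polynomials do not vanish on all tuples of naturals *)

Lemma base_expansion_inj (d k : nat) (a b : 'I_k -> nat) :
  (forall i, a i < d)%N -> (forall i, b i < d)%N ->
  (\sum_(i < k) a i * d ^ i)%N = (\sum_(i < k) b i * d ^ i)%N -> a =1 b.
Proof.
elim: k a b => [|k IH] a b ltad ltbd; first by move=> _ [].
have d_gt0 : (0 < d)%N by apply: leq_ltn_trans (ltad ord0).
have expand (c : 'I_k.+1 -> nat) :
    (\sum_(i < k.+1) c i * d ^ i =
     (\sum_(i < k) c (lift ord0 i) * d ^ i) * d + c ord0)%N.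
  rewrite big_ord_recl muln1 addnC big_distrl /=; congr (_ + _)%N.
  by apply: eq_bigr => i _; rewrite /bump /= add1n expnSr mulnA.
rewrite !expand => eq_ab.
have eq0 : a ord0 = b ord0.
  by have := congr1 (modn^~ d) eq_ab; rewrite /= !modnMDl !modn_small.
have eqS : (fun i => a (lift ord0 i)) =1 (fun i => b (lift ord0 i)).
  apply: IH => //.
  have := congr1 (divn^~ d) eq_ab.
  by rewrite /= !divnMDl // !divn_small // !addn0.
by move=> i; case: (unliftP ord0 i) => [j|] -> //; exact: eqS.
Qed.

Lemma exists_nat_nonroot1 (R : realType) (p : {poly R}) :
  (p != 0 -> exists n : nat, p.[n%:R] != 0)%R.
Proof.
move=> p_neq0; apply: contrapT => noroot.
suff : (size p < size p)%N by rewrite ltnn.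
have := @max_poly_roots _ p [seq i%:R%R | i <- iota 0 (size p)] p_neq0.
rewrite size_map size_iota; apply.
  apply/allP => _ /mapP[i _ ->]; apply: contrapT => /negP nz.
  by apply: noroot; exists i.
by rewrite map_inj_uniq ?iota_uniq// => i j /eqP; rewrite eqr_nat => /eqP.
Qed.

(** Kronecker's substitution [X_i := X ^ (d ^ i)], with [d] larger than all the
exponents, sends distinct monomials of [P] to distinct powers of [X] by
uniqueness of expansions in base [d], so it reduces the claim to one variable. *)
Lemma exists_nat_nonroot (R : realType) (k : nat) (P : mpoly.mpoly k R) :
  (P != 0)%R -> exists v : 'I_k -> nat,
    (mpoly.meval (fun i => (v i)%:R%R) P != 0)%R.
Proof.
move=> P_neq0.
pose d := mpoly.msize P.
pose e (m : mpoly.multinom k) := (\sum_(i < k) m i * d ^ i)%N.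
pose Q : {poly R} :=
  (\sum_(m <- mpoly.msupp P) mpoly.mcoeff m P *: 'X^(e m))%R.
have m_lt m i : m \in mpoly.msupp P -> (m i < d)%N.
  move=> /mpoly.msize_mdeg_lt; apply: leq_ltn_trans.
  by rewrite mpoly.mdegE (bigD1 i) //= leq_addr.
have Q_neq0 : (Q != 0)%R.
  have : mpoly.msupp P != [::] by rewrite mpoly.msupp_eq0.
  case Esupp : (mpoly.msupp P) => [//|m0 s] _.
  have m0P : m0 \in mpoly.msupp P by rewrite Esupp mem_head.
  apply/eqP => /(congr1 (fun q : {poly R} => q`_(e m0)))%R.
  rewrite coef0 coef_sum (bigD1_seq m0) ?mpoly.msupp_uniq//=.
  rewrite coefZ coefXn eqxx mulr1 big1_seq ?addr0 => [|m].
    by move/eqP; rewrite mpoly.mcoeff_eq0 m0P.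
  case/andP=> m_neq mP; rewrite coefZ coefXn.
  case: eqP => [em|_]; last by rewrite mulr0.
  case/eqP: m_neq; apply/mpoly.mnmP => i; apply/esym.
  by apply: (base_expansion_inj _ _ _ _ _ _ em) => j; exact: m_lt.
have [n Qn] := exists_nat_nonroot1 R Q Q_neq0.
exists (fun i => n ^ (d ^ i))%N; apply: contra_neq Qn => Pn.
rewrite -[RHS]Pn mpoly.mevalE /Q horner_sum; apply: eq_bigr => m _.
rewrite hornerZ hornerXn; congr (_ * _)%R.
rewrite /e -prodrXr; apply: eq_bigr => i _.
by rewrite -!natrX -expnM mulnC.
Qed.

(** * An independent family of sequences indexed by the sets of naturals *)

Definition trace (A : set nat) (m : nat) : seq bool :=
  mkseq (fun j => `[< A j >]) m.

(** The index [n] is read as a code for a length [m] and a finite table [t];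
the value at [n] is then looked up in the table under the key given by the
first [m] bits of [A].  Summing over the matching entries avoids a choice of
one of them. *)
Definition independent_seq (A : set nat) (n : nat) : nat :=
  if unpickle n is Some (m, t) then
    (\sum_(p <- (t : seq (seq bool * nat)) | p.1 == trace A m) p.2)%N
  else 0%N.

(** Finitely many distinct sets differ below a common bound. *)
Lemma traces_inj (k : nat) (A : 'I_k -> set nat) :
  injective A -> exists m, injective (fun i => trace (A i) m).
Proof.
move=> A_inj.
have /choice[N NP] (ij : 'I_k * 'I_k) : exists n, ij.1 != ij.2 ->
    `[< A ij.1 n >] <> `[< A ij.2 n >].
  case: (eqVneq ij.1 ij.2) => [|ij_neq]; first by exists 0%N.
  apply: contrapT => /forallNP same; move: ij_neq => /eqP; apply.
  apply/A_inj/funext => n; rewrite -[LHS]asboolE -[RHS]asboolE.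
  by congr is_true; apply: contrapT => Aij; apply: (same n).
exists (\max_ij (N ij).+1) => i j /(congr1 (nth false ^~ (N (i, j)))).
have Nm : (N (i, j) < \max_ij (N ij).+1)%N by exact: (leq_bigmax (i, j)).
rewrite !nth_mkseq // => Aij.
by apply/eqP; apply: contrapT => /negP /(NP (i, j)); apply.
Qed.

(** At a length where the traces of the sets are distinct, the table that maps
these traces to the values [v] is unambiguous; its code is the index. *)
Lemma independent_seqP (k : nat) (A : 'I_k -> set nat) (v : 'I_k -> nat) :
  injective A -> exists n, forall i, independent_seq (A i) n = v i.
Proof.
move=> /traces_inj[m tr_inj].
pose t := [seq (trace (A i) m, v i) | i <- enum 'I_k].
exists (pickle (m, t)) => i.
rewrite /independent_seq pickleK big_map big_enum_cond /=.
by rewrite (big_pred1 i) // => j; rewrite /= (inj_eq tr_inj).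
Qed.

(** * Functions vanishing outside the naturals *)

Section Spikes.
Variable R : realType.
Implicit Types (a : nat -> R) (x : R).
Local Open Scope ring_scope.

Definition spikes a x : R :=
  if x \is a Num.nat then a (Num.truncn x) else 0.

Lemma spikes_nat a n : spikes a n%:R = a n.
Proof. by rewrite /spikes natr_nat natrK. Qed.

Lemma spikes_non_nat a x : x \isn't a Num.nat -> spikes a x = 0.
Proof. by rewrite /spikes => /negbTE ->. Qed.

Definition bump (n i : nat) x : R := Num.max 0 (1 - n%:R * `|x - i%:R|).

Lemma bump_continuous n i : continuous (bump n i).
Proof.
move=> x.
apply: (@continuous_max R R (cst 0) (fun x => 1 - n%:R * `|x - i%:R|)).
  exact: cvg_cst.
apply: cvgB; first exact: cvg_cst.
apply: cvgM; first exact: cvg_cst.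
by apply: cvg_norm; apply: cvgB; [exact: cvg_id | exact: cvg_cst].
Qed.

Lemma bump_center n i : bump n i i%:R = 1.
Proof. by rewrite /bump subrr normr0 mulr0 subr0 max_r. Qed.

Lemma bump_far n i x : 1 <= n%:R * `|x - i%:R| -> bump n i x = 0.
Proof. by move=> far; rewrite /bump max_l // subr_le0. Qed.

(** The naturals form a closed discrete set: only those up to the integer part
of [x] plus one can come closer to [x] than [1]. *)
Lemma dist_nat_gt0 x :
  exists2 e : R, 0 < e & forall i : nat, x != i%:R -> e <= `|x - i%:R|.
Proof.
pose N := (Num.truncn x).+2.
exists (\big[Num.min/1]_(i < N | x != i%:R) `|x - i%:R|).
  by apply/lt_bigmin => // i; rewrite normr_gt0 subr_eq0.
move=> i xi; case: (ltnP i N) => [iN|Ni].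
  exact: (bigmin_le_cond _ (j := Ordinal iN)).
apply: (le_trans (bigmin_le_id _ _ _ _)).
rewrite distrC; apply: (le_trans _ (ler_norm _)).
have xN : x < (Num.truncn x).+1%:R by exact: truncnS_gt.
have : (N%:R : R) <= i%:R by rewrite ler_nat.
by rewrite /N -natr1; lra.
Qed.

(** At each point [x] the sums of bumps are eventually constant: once the
half-width [n^-1] of the bumps is at most the distance from [x] to the naturals
other than [x], only a bump centred at [x] itself contributes, and this bump
is among the summands as soon as [n] exceeds [x]. *)
Lemma spikes_baire_one a : baire_one (spikes a).
Proof.
exists (fun n x => \sum_(i < n) a i * bump n i x); split.
  move=> n; have -> : (fun x => \sum_(i < n) a i * bump n i x) =
      \sum_(i < n) (fun x => a i * bump n i x).
    by apply/funext => x; rewrite fct_sumE.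
  elim/big_ind: _ => [|f g fc gc|i _] x; first exact: cvg_cst.
    by apply: cvgD; [exact: fc | exact: gc].
  by apply: cvgM; [exact: cvg_cst | exact: bump_continuous].
move=> x; have [e e_gt0 eP] := dist_nat_gt0 x.
apply: cvg_near_cst; near=> n.
have far (i : 'I_n) : x != i%:R -> a i * bump n i x = 0.
  move=> /eP xi; rewrite bump_far ?mulr0 //.
  apply: (@le_trans _ _ (n%:R * e)); last by rewrite ler_wpM2l.
  by rewrite -ler_pdivrMr // div1r; near: n; exact: nbhs_infty_ger.
case: (boolP (x \is a Num.nat)) => [/natrP[j xj]|x_nat]; last first.
  rewrite spikes_non_nat // big1 // => i _; apply: far.
  by apply: contraNneq x_nat => ->.
have jn : (j < n)%N.
  by rewrite -[j](@natrK R) -xj; near: n; exact: nbhs_infty_gt.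
rewrite (bigD1 (Ordinal jn)) //= big1 ?addr0 => [|i ij].
  by rewrite xj bump_center mulr1 spikes_nat.
by apply: far; rewrite xj eqr_nat eq_sym.
Unshelve. all: by end_near. Qed.

Lemma nat_unit_itv n x : n%:R <= x < n.+1%:R -> x \is a Num.nat -> x = n%:R.
Proof. by move=> /truncn_def xn /truncnK; rewrite xn => ->. Qed.

(** The value [a n / 2] lies between those at [n] and at [n + 1/2], but it is
not taken in between: there the function vanishes except at [n]. *)
Lemma spikes_not_darboux a n : a n != 0 -> ~ darboux (spikes a).
Proof.
move=> an_neq0 dx; pose I : set R := `[n%:R, n%:R + 2^-1]%classic.
have /connected_intervalP img_itv := dx I (@interval_is_interval _ _).
have in_I x : I x -> n%:R <= x < n.+1%:R.
  by rewrite /I /= in_itv /= -[n.+1%:R]natr1; lra.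
have img_n : (spikes a @` I) (a n).
  by exists n%:R; rewrite ?spikes_nat // /I /= in_itv /=; lra.
have img_0 : (spikes a @` I) 0.
  have I_half : I (n%:R + 2^-1) by rewrite /I /= in_itv /=; lra.
  exists (n%:R + 2^-1) => //; apply: spikes_non_nat; apply/negP.
  by move=> /(nat_unit_itv _ _ (in_I _ I_half)); lra.
have [x xI] : (spikes a @` I) (a n / 2).
  have [an_ge0|an_le0] := lerP 0 (a n).
    by apply: img_itv img_0 img_n _ _; lra.
  by apply: img_itv img_n img_0 _ _; lra.
case: (boolP (x \is a Num.nat)) => [/(nat_unit_itv _ _ (in_I _ xI)) ->|x_nat].
  by rewrite spikes_nat; lra.
by rewrite spikes_non_nat //; lra.
Qed.

End Spikes.

(** * The algebra generated by the independent family *)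

Lemma meval0_const (R : realType) (k : nat) (P : mpoly.mpoly k R) :
  (mpoly.mcoeff mpoly.mnm0 P = 0 -> mpoly.meval (fun=> 0) P = 0)%R.
Proof.
move=> P0; rewrite mpoly.mevalE big1 // => m _.
case: (eqVneq m mpoly.mnm0) => [->|m_neq0]; first by rewrite P0 mul0r.
have [i mi] : exists i, m i != 0%N.
  apply: contrapT => /forallNP m0; case/eqP: m_neq0; apply/mpoly.mnmP => i.
  by rewrite mpoly.mnm0E; apply/eqP; apply: contrapT => /negP; exact: m0.
by rewrite (bigD1 i) //= expr0n (negbTE mi) mul0r mulr0.
Qed.

Definition independent_spikes (R : realType) (A : set nat) : R -> R :=
  spikes R (fun n => (independent_seq A n)%:R)%R.

(** The vanishing constant term is what makes the polynomial combination zero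
outside the naturals. *)
Lemma mmap_independent_spikes (R : realType) (k : nat) (P : mpoly.mpoly k R)
    (A : 'I_k -> set nat) :
  (mpoly.mcoeff mpoly.mnm0 P = 0)%R ->
  mpoly.mmap (GRing.in_alg (R -> R)%type)
    (fun i => independent_spikes R (A i)) P =
  spikes R (fun n => mpoly.meval (fun i => (independent_seq (A i) n)%:R)%R P).
Proof.
move=> P0; apply/funext => x; rewrite mmap_fctE /independent_spikes /spikes.
by case: ifP => // _; exact: meval0_const.
Qed.

(** Two distinct sets can be given the distinct values [0] and [1] at a common
index. *)
Lemma independent_spikes_inj (R : realType) : injective (independent_spikes R).
Proof.
move=> A B AB; apply: contrapT => A_neq_B.
have [|n sn] := independent_seqP 2 (fun i => if i == ord0 then A else B)
  (fun i => i : nat).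
  move=> i j; case: eqP => [->|iN]; case: eqP => [->|jN] //.
  - by move/esym.
  - have is_max (l : 'I_2) : l <> ord0 -> l = ord_max.
      case: l => -[|[|//]] l2 lN; apply/val_inj => //.
      by case: lN; apply/val_inj.
    by rewrite (is_max _ iN) (is_max _ jN).
have := congr1 (@^~ n%:R%R) AB; rewrite /independent_spikes !spikes_nat.
move/eqP; rewrite eqr_nat; have /= -> := sn ord0; have /= -> := sn ord_max.
by [].
Qed.

Theorem theorem5p4 (R : realType) :
  strongly_algebrable R (R -> R)%type continuum (B1 R `\` DB1 R).
Proof.
exists (range (independent_spikes R)); split.
  by apply: inj_card_eq => A B _ _; exact: independent_spikes_inj.
move=> k P y _ P_neq0 P0 y_inj yX.
have /choice[A yA] (i : 'I_k) : exists A, independent_spikes R A = y i.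
  by have [A _ <-] := yX i; exists A.
have {}yA : y = fun i => independent_spikes R (A i) by apply/funext.
have A_inj : injective A by move=> i j Aij; apply: y_inj; rewrite yA Aij.
have [v Pv] := exists_nat_nonroot R k P P_neq0.
have [n nv] := independent_seqP k A v A_inj.
rewrite yA mmap_independent_spikes //.
set a := fun n => _.
have an_neq0 : (a n != 0)%R.
  rewrite /a (_ : (fun i => _) = (fun i => (v i)%:R)%R) //.
  by apply/funext => i; rewrite nv.
split; last split.
- by move=> /(congr1 (@^~ n%:R%R)); rewrite spikes_nat; exact/eqP.
- exact: spikes_baire_one.
- by case=> _; exact: spikes_not_darboux an_neq0.
Qed.
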